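(* For all integers $p\geq 2$, ${\rm ex}(n,S_p)=O(n^{7/5})$.
   Context: A $3$-comb $T_3$ is the tree obtained from a path $abc$ by adding three new vertices $a',b',c'$ and edges $aa',bb',cc'$. For $p\ge 2$, the $3$-comb-pasting $S_p$ is the graph obtained by taking $p$ vertex-disjoint copies of $T_3$ and then identifying all images of $a'$ into one vertex, all images of $b'$ into one vertex, and all images of $c'$ into one vertex. ${\rm ex}(n,H)$ is the maximum number of edges in an $n$-vertex graph containing no copy of $H$; the constant in $O(\cdot)$ may depend on $p$. *)

(* Defs.v *)
From mathcomp Require Import all_boot.

Set Implicit Arguments.
Unset Strict Implicit.
Unset Printing Implicit Defensive.

(* A graph on the vertex type V is given by its set of edges, a set of vertex
   sets; it is simple when every edge is an unordered pair of distinct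
   vertices. *)
Definition simple_graph (V : finType) (E : {set {set V}}) : bool :=
  [forall e in E, #|e| == 2].

(* "G contains a copy of H": H is isomorphic to a subgraph, not necessarily
   induced, of G. *)
Definition contains_copy (W V : finType) (H : {set {set W}})
    (G : {set {set V}}) : bool :=
  [exists f : {ffun W -> V},
     injectiveb f && [forall e in H, f @: e \in G]].

Definition extremal_number (n : nat) (W : finType) (H : {set {set W}}) : nat :=
  \max_(G : {set {set 'I_n}} | simple_graph G && ~~ contains_copy H G) #|G|.

(* inl 0, inl 1, inl 2 are the vertices a, b, c of the path, and
   inr 0, inr 1, inr 2 are the pendant vertices a', b', c'. *)
Definition comb_vertex : finType := ('I_3 + 'I_3)%type.

Definition comb3 : {set {set comb_vertex}} :=
  [set [set inl i; inl j] | i in 'I_3, j in [set j : 'I_3 | j == i.+1 :> nat]]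
  :|: [set [set inl i; inr i] | i : 'I_3].

Definition disjoint_copies (p : nat) (V : finType) (E : {set {set V}}) :
    {set {set 'I_p * V}} :=
  [set [set (i, v) | v in e] | i : 'I_p, e : {set V} in E].

(* inl l is the vertex obtained by merging the p images of the pendant vertex
   inr l of the comb; inr (i, s) is the path vertex inl s of the i-th copy. *)
Definition pasting_vertex (p : nat) : finType := ('I_3 + 'I_p * 'I_3)%type.

Definition paste (p : nat) (x : 'I_p * comb_vertex) : pasting_vertex p :=
  match x.2 with
  | inl s => inr (x.1, s)
  | inr l => inl l
  end.

Definition comb_pasting (p : nat) : {set {set pasting_vertex p}} :=
  [set [set paste x | x in e] | e : {set 'I_p * comb_vertex} in disjoint_copies p comb3].

(* Main.v *)
Require Import Defs.
From mathcomp Require Import all_boot.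
From mathcomp Require Import zify.

(* [S_p] consists of [p] paths [x a_i b_i c_i z] whose midpoints [b_i] are joined
   to [y].  Suppose that no triple [(x, y, z)] roots many robustly disjoint combs.

   If many 2-walks from [y] end at vertices [a] having at least [K] neighbours in
   [N(y)], most pairs in [N(a) :&: N(y)] have many common neighbours, since only
   [O(deg(y)^2)] incidences come from pairs with few.  For large [K] these pairs
   contain a [K_{2,q+1}], from which a rich triple is read off.  So all but a small
   fraction of the 2-walks have ends with fewer than [K] common neighbours.

   In an almost regular graph with [N] vertices and degrees about [d], most of the
   [N d^5] combs are then made of such 2-walks only.  Given the roots, any fixed
   inner vertex lies in [O(K^2)] of these combs, so there are [O(1)] of them per
   triple and [N d^5 = O(N^3)].

   Almost regularity comes from a vertex subset maximizing [edges / size^(7/5)]: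
   there the vertices of degree much above average carry few edges. *)

Set Implicit Arguments.
Unset Strict Implicit.
Unset Printing Implicit Defensive.

(** * Rich triples and disjoint combs *)

Definition degree (V : finType) (r : rel V) (v : V) : nat := #|[set u | r v u]|.

Definition codeg (V : finType) (r : rel V) (u v : V) : nat :=
  #|[set w | r u w && r v w]|.

Lemma codegC (V : finType) (r : rel V) (u v : V) : codeg r u v = codeg r v u.
Proof. by apply: eq_card => w; rewrite !inE andbC. Qed.

(** Distinctness is stated only for [a] and [c]: in a loopless graph [b] differs from both by
    adjacency, and a forbidden set containing the roots keeps [a], [b], [c] off them. *)
Definition is_comb (V : finType) (r : rel V) (x y z a b c : V) : bool :=
  [&& r a x, r b y, r c z, r b a, r b c & a != c].

(* The combs rooted at [(x, y, z)] cannot be destroyed by [q] vertices; for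
   [q = 3 * p] a greedy choice then yields [p] disjoint ones. *)
Definition rich (V : finType) (r : rel V) (q : nat) (x y z : V) : bool :=
  uniq [:: x; y; z] &&
  [forall F : {set V}, (#|F| <= q) ==>
     [exists a, exists b, exists c,
        [&& is_comb r x y z a b c, a \notin F, b \notin F & c \notin F]]].

Lemma sum_bool_card (V : finType) (P Q : pred V) :
  \sum_(x | P x) (Q x : nat) = #|[set x | P x && Q x]|.
Proof.
rewrite -sum1_card big_mkcond [RHS]big_mkcond /=; apply: eq_bigr => x _.
by rewrite inE; case: (P x); case: (Q x).
Qed.

Lemma exists_outside (V : finType) (A F : {set V}) :
  #|F| < #|A| -> exists2 x, x \in A & x \notin F.
Proof.
move=> ltFA; apply/subsetPn; apply: contraL ltFA => sAF.
by rewrite -leqNgt subset_leq_card.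
Qed.

Lemma comb_avoiding (V : finType) (r : rel V) (q : nat) (x y z : V)
    (F : {set V}) :
  rich r q x y z -> #|F| <= q ->
  exists a b c,
    [/\ is_comb r x y z a b c, a \notin F, b \notin F & c \notin F].
Proof.
case/andP=> _ /forallP/(_ F)/implyP richF /richF.
by case/existsP=> a /existsP[b /existsP[c /and4P[]]]; exists a, b, c.
Qed.

(** Greedy choice: each comb taken is added to the forbidden set at a cost of three vertices. No
    comb has to avoid the last one, whence [k.-1]. *)
Lemma disjoint_combs (V : finType) (r : rel V) (q k : nat) (x y z : V)
    (F : {set V}) :
  rich r q x y z -> #|F| + 3 * k.-1 <= q ->
  exists t : nat -> 'I_3 -> V,
    [/\ forall i, i < k ->
          is_comb r x y z (t i ord0) (t i (inord 1)) (t i (inord 2)),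
        forall i s, i < k -> t i s \notin F
      & forall i j s s', i < k -> j < k -> t i s = t j s' -> i = j].
Proof.
move=> hrich; elim: k F => [|k IHk] F hq; first by exists (fun _ _ => x).
have {}/comb_avoiding hF := hrich.
have [|a [b [c [habc aF bF cF]]]] := hF F; first by lia.
set F' := [set a; b; c] :|: F.
have cF' : #|F'| <= 3 + #|F|.
  apply: leq_trans (leq_card_setU _ _) _; rewrite leq_add2r.
  by rewrite -setUA !cardsU1 cards1; do 2! case: (_ \in _).
(* When this comb is the only one, [F'] may exceed the budget [q], so the induction hypothesis is
   not called. *)
have [hk|hk] := posnP k.
  exists (fun _ (s : 'I_3) => nth a [:: a; b; c] s); split.
  - by move=> i _; rewrite /= !inordK.
  - by move=> i [[|[|[|]]] ?].
  - by move=> i j s s'; rewrite hk; lia.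
have [|t [ht tF tinj]] := IHk F'; first by lia.
have tF3 i (s : 'I_3) : i < k -> forall s' : 'I_3, t i s <> nth a [:: a; b; c] s'.
  move=> ik s' e; have := tF i s ik; rewrite e !inE.
  by case: s' {e} => [[|[|[|]]] ?] //=; rewrite eqxx ?orbT.
exists (fun i (s : 'I_3) => if i is i'.+1 then t i' s else nth a [:: a; b; c] s); split.
- by case=> [|i] ik; [rewrite !inordK | apply: ht].
- case=> [|i] s ik; first by case: s => [[|[|[|]]] ?].
  by have := tF i s ik; rewrite inE negb_or => /andP[].
- case=> [|i] [|j] s s' ik jk //.
  + by move/esym/tF3 => [].
  + by move/tF3 => [].
  + by move/tinj=> ->.
Qed.

(** * Heavy pairs and bad walks *)

Lemma leq_sum_sub (V : finType) (P Q : pred V) (f : V -> nat) :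
  (forall x, P x -> Q x) -> \sum_(x | P x) f x <= \sum_(x | Q x) f x.
Proof.
move=> PQ; rewrite big_mkcond [X in _ <= X]big_mkcond; apply: leq_sum => x _.
by case: ifP => // /PQ ->.
Qed.

(* Call [x], [b] heavy when they have more than [q + 1] common neighbours.  Two
   neighbours [x], [z] of [y] with more than [q] common heavy partners [b] in [S]
   would make [(x, y, z)] rich, so the heavy graph on [S] contains no
   [K_{2,q+1}] and is sparse. *)
Lemma few_heavy_pairs (V : finType) (r : rel V) (q : nat) (y : V)
    (S : {set V}) :
  symmetric r -> irreflexive r -> (forall x z, ~~ rich r q x y z) ->
  (forall x, x \in S -> r y x) -> 16 * q.+1 < #|S| ->
  4 * \sum_(b in S) \sum_(x in S) ((x != b) && (q.+1 < codeg r x b) : nat)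
    <= #|S| ^ 2.
Proof.
move=> rS rI norich Sy hS; set s := #|S|.
set hv := fun x b => (x != b) && (q.+1 < codeg r x b).
set hd := fun b => \sum_(x in S) (hv x b : nat).
have hcod x z : x \in S -> z \in S -> x != z ->
    \sum_(b in S) (hv x b * hv z b) <= q.
  move=> xS zS xz; under eq_bigr do rewrite mulnb.
  rewrite sum_bool_card leqNgt; apply/negP=> hq.
  have /negP[] := norich x z; apply/andP; split.
    have ny v : v \in S -> v != y.
      by move/Sy=> h; apply/eqP=> e; rewrite e rI in h.
    by rewrite /= !inE negb_or ny // xz eq_sym ny.
  apply/forallP=> F; apply/implyP=> qF.
  have [b] := exists_outside (leq_ltn_trans qF hq).
  rewrite inE => /and3P[bS /andP[_ xb] /andP[_ zb]] bF.
  have [a] := exists_outside (ltn_trans (leq_ltn_trans qF (ltnSn _)) xb).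
  rewrite inE => /andP[xa ba] aF.
  (* [c] must avoid [a] besides [F]; this is why heavy means more than [q.+1] common neighbours. *)
  have [|c] := @exists_outside _ [set w | r z w && r b w] (a |: F).
    by apply: leq_ltn_trans zb; rewrite cardsU1 aF.
  rewrite !inE negb_or => /andP[zc bc] /andP[ca cF].
  apply/existsP; exists a; apply/existsP; exists b; apply/existsP; exists c.
  rewrite aF bF cF !andbT /is_comb ![r _ x]rS ![r _ z]rS xa zc ba bc.
  by rewrite rS (Sy _ bS) eq_sym.
(* Counts each [b] with an ordered pair of heavy partners: for fixed [x], the diagonal [z = x] gives
   at most [s] and every other [z] at most [q]. *)
have hsq : \sum_(b in S) hd b ^ 2 <= s * (s + s * q).
  have -> : \sum_(b in S) hd b ^ 2 =
      \sum_(x in S) \sum_(z in S) \sum_(b in S) hv x b * hv z b.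
    under eq_bigr => b _ do
      rewrite expnS expn1 /hd big_distrl /=; rewrite exchange_big /=.
    apply: eq_bigr => x _; rewrite [RHS]exchange_big /=.
    by apply: eq_bigr => b _; rewrite big_distrr.
  have -> : s * (s + s * q) = \sum_(x in S) (s + s * q) by rewrite sum_nat_const.
  apply: leq_sum => x xS; rewrite (bigD1 x) //= leq_add //.
    rewrite /s -sum1_card; apply: leq_sum => b _.
    by case: (hv x b).
  have -> : s * q = \sum_(z in S) q by rewrite sum_nat_const.
  apply: leq_trans (leq_sum_sub (P := fun z => (z \in S) && (z != x)) _ _); last first.
    by move=> z /andP[].
  by apply: leq_sum => z /andP[zS zx]; apply: hcod => //; rewrite eq_sym.
(* AM-GM for [s] and [4 * hd b]. Since [16 * q.+1 < s], the right side is at most [2 * s ^ 3]. *)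
have amgm : 8 * s * \sum_(b in S) hd b <= s * s ^ 2 + 16 * (s * (s + s * q)).
  apply: leq_trans (_ : \sum_(b in S) (s ^ 2 + 16 * hd b ^ 2) <= _); last first.
    by rewrite big_split sum_nat_const -big_distrr leq_add2l leq_mul2l.
  rewrite big_distrr /=; apply: leq_sum => b _.
  by have [+ _] := nat_Cauchy s (4 * hd b); rewrite expnMn; lia.
rewrite -/s in hS; rewrite -(@leq_pmul2l (2 * s)); last by lia.
have -> : \sum_(b in S) \sum_(x in S) ((x != b) && (q.+1 < codeg r x b) : nat)
   = \sum_(b in S) hd b by [].
move: amgm; set h := \sum_(b in S) hd b => amgm.
have : 16 * (s * (s + s * q)) <= s * s ^ 2 by nia.
nia.
Qed.

(* Walks [v b a] are called bad when their ends have at least [K] common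
   neighbours; [a = v] is allowed. *)
Definition bad_walks (V : finType) (r : rel V) (K : nat) (v : V) : nat :=
  \sum_(b | r v b) \sum_(a | r b a) (K <= codeg r v a : nat).

(* Each [a] ending a bad walk spans mostly light pairs in [N(a) :&: N(y)], and a
   light pair has at most [q + 1] common neighbours [a]. *)
Lemma bad_walks_le (V : finType) (r : rel V) (q K : nat) (y : V) :
  symmetric r -> irreflexive r -> (forall x z, ~~ rich r q x y z) ->
  16 * q.+1 < K -> K * bad_walks r K y <= 2 * q.+1 * degree r y ^ 2.
Proof.
move=> rS rI norich hK.
set A := [pred a | K <= codeg r y a].
have -> : bad_walks r K y = \sum_(a | A a) codeg r y a.
  rewrite /bad_walks.
  under eq_bigr => b _ do rewrite big_mkcond.
  rewrite exchange_big /= [RHS]big_mkcond; apply: eq_bigr => a _.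
  rewrite -big_mkcondr /=; case: ifP => hA; last first.
    by rewrite big1.
  rewrite sum_nat_const muln1; apply: eq_card => b.
  by rewrite !inE [r a b]rS.
set lt := fun a => \sum_(b | r y b && r a b) \sum_(x | r y x && r a x)
   (codeg r x b <= q.+1 : nat).
apply: leq_trans (_ : \sum_(a | A a) 2 * lt a <= _).
  rewrite big_distrr /=; apply: leq_sum => a Aa.
  set S := [set w | r y w && r a w].
  have sE : #|S| = codeg r y a by [].
  have hS : 16 * q.+1 < #|S| by apply: leq_trans hK _.
  have := @few_heavy_pairs V r q y S rS rI norich _ hS.
  have Sy x : x \in S -> r y x by rewrite inE => /andP[].
  move/(_ Sy); set h := \sum_(b in S) _ => hh.
  have ltE : lt a = \sum_(b in S) \sum_(x in S) (codeg r x b <= q.+1 : nat).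
    apply: eq_big => b; first by rewrite inE.
    by move=> _; apply: eq_bigl => x; rewrite inE.
  (* Every ordered pair in [S] is heavy, light or diagonal. Heavy ones make up at most a quarter and
     [#|S| > 16], so [2 * lt a >= #|S| ^ 2 >= K * #|S|]. *)
  have tot : #|S| ^ 2 <= h + lt a + #|S|.
    rewrite ltE -[X in _ + X]sum1_card -!big_split /= expnS expn1.
    rewrite -{1}sum1_card big_distrl /=.
    apply: leq_sum => b bS; rewrite mul1n -sum1_card.
    rewrite [X in _ <= _ + X](_ : 1 = \sum_(x in S) (x == b : nat)); last first.
      by rewrite (bigD1 b) //= eqxx big1 // => x /andP[_ /negbTE ->].
    rewrite -!big_split /=; apply: leq_sum => x xS.
    by rewrite [q.+1 < _]ltnNge; case: (x == b); case: (codeg r x b <= _).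
  rewrite -sE; apply: leq_trans (_ : #|S| ^ 2 <= _); last by nia.
  by rewrite expnS expn1 leq_mul2r sE Aa orbT.
rewrite -big_distrr /= -mulnA leq_mul2l /=.
apply: leq_trans (leq_sum_sub (Q := predT) lt _) _ => //.
(* Double counting: a light pair [b], [x] of neighbours of [y] is counted once for each of its at
   most [q.+1] common neighbours [a]. *)
have -> : \sum_a lt a = \sum_(b | r y b) \sum_(x | r y x)
    \sum_(a | r b a && r x a) (codeg r x b <= q.+1 : nat).
  rewrite /lt; under eq_bigr => a _ do rewrite big_mkcondr /=.
  rewrite exchange_big /=; apply: eq_bigr => b _.
  rewrite -big_mkcond /=.
  under eq_bigr => a _ do rewrite big_mkcondr /=.
  rewrite exchange_big /=; apply: eq_bigr => x _.
  rewrite -big_mkcondr /=; apply: eq_bigl => a.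
  by rewrite ![r a _]rS.
have -> : q.+1 * degree r y ^ 2 = \sum_(b | r y b) \sum_(x | r y x) q.+1.
  rewrite !sum_nat_const /degree expnS expn1 mulnC -mulnA cardsE; congr (_ * (_ * _)).
apply: leq_sum => b _; apply: leq_sum => x _.
rewrite sum_nat_const; case: (leqP (codeg r x b) q.+1) => h; last by rewrite muln0.
rewrite muln1; apply: leq_trans h; rewrite leq_eqVlt; apply/orP; left.
by apply/eqP; apply: eq_card => w; rewrite !inE andbC.
Qed.

(** * Counting combs in an almost regular graph *)

Definition link (V : finType) (r : rel V) (K : nat) (u v w : V) : bool :=
  [&& r u w, r v w & codeg r u v < K].

Definition good_comb (V : finType) (r : rel V) (K : nat) (x y z a b c : V) :
    bool :=
  [&& link r K x b a, link r K b z c, link r K y a b, link r K y c b & a != c].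

Lemma sum_link_le (V : finType) (r : rel V) (K : nat) (u v : V) :
  \sum_w (link r K u v w : nat) <= K.
Proof.
rewrite sum_bool_card /link; case: (ltnP (codeg r u v) K) => h.
  apply: leq_trans (ltnW h); apply: eq_leq; apply: eq_card => w.
  by rewrite !inE andbT.
by rewrite eq_card0 // => w; rewrite !inE !andbF.
Qed.

(** The ends of the second link may depend on [w]: with [a] fixed, [b] links [y] to [a], and only
    then does [c] link [b] to [z]. *)
Lemma sum_link_pair_le (V : finType) (r : rel V) (K : nat) (u v : V)
    (f g : V -> V) :
  \sum_w \sum_w' (link r K u v w * link r K (f w) (g w) w') <= K * K.
Proof.
apply: leq_trans (_ : \sum_w link r K u v w * K <= _).
  by apply: leq_sum => w _; rewrite -big_distrr leq_mul2l sum_link_le orbT.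
by rewrite -big_distrl leq_mul2r sum_link_le orbT.
Qed.

Lemma sum_indicator (V : finType) (F : {set V}) (f : V -> nat) :
  \sum_v (v \in F) * f v = \sum_(v in F) f v.
Proof.
rewrite [RHS]big_mkcond; apply: eq_bigr => v _.
by case: (v \in F); rewrite ?mul1n.
Qed.

(* Fixing any one of [a], [b], [c] leaves at most [K ^ 2] good combs, so [q]
   vertices cannot meet more than [3 q K ^ 2] of them. *)
Lemma good_combs_le (V : finType) (r : rel V) (q K : nat) (x y z : V) :
  symmetric r -> uniq [:: x; y; z] -> ~~ rich r q x y z ->
  \sum_b \sum_a \sum_c (good_comb r K x y z a b c : nat) <= 3 * q * K ^ 2.
Proof.
move=> rS hu; rewrite /rich hu /= negb_forall => /existsP[F].
rewrite negb_imply => /andP[qF /existsPn hF].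
set g := good_comb r K x y z.
have hit a b c : g a b c -> [|| a \in F, b \in F | c \in F].
  case/and5P=> /and3P[xa ba _] /and3P[_ zc _] /and3P[yb ab _] /and3P[_ cb _] ac.
  have := hF a; apply: contraR; rewrite !negb_or => hn.
  apply/existsP; exists b; apply/existsP; exists c; rewrite hn andbT /is_comb.
  by rewrite ac ba [r b y]rS [r b c]rS [r a x]rS [r c z]rS xa yb zc cb.
(* In each term the fixed vertex and the roots leave two links to be chosen one after the other, in
   at most [K] ways each. *)
have gle a b c : (g a b c : nat) <=
    (a \in F) * (link r K y a b * link r K b z c)
    + (b \in F) * (link r K x b a * link r K b z c)
    + (c \in F) * (link r K y c b * link r K x b a).
  case hg : (g a b c) => //.
  have := hit _ _ _ hg; move: hg; rewrite /g /good_comb.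
  case/and5P=> -> -> -> -> _.
  by do 3! case: (_ \in F).
apply: leq_trans (_ : \sum_b \sum_a \sum_c
    ((a \in F) * (link r K y a b * link r K b z c)
    + (b \in F) * (link r K x b a * link r K b z c)
    + (c \in F) * (link r K y c b * link r K x b a)) <= _).
  by do 3! [apply: leq_sum => ? _].
have -> : 3 * q * K ^ 2 = q * (K * K) + q * (K * K) + q * (K * K) by nia.
do 2! under eq_bigr do under eq_bigr do rewrite big_split /=.
do 2! under eq_bigr do rewrite big_split /=.
rewrite !big_split /=.
have fin (f : V -> nat) : (forall v, f v <= K * K) ->
    \sum_v (v \in F) * f v <= q * (K * K).
  move=> hf; rewrite sum_indicator; apply: leq_trans (_ : \sum_(v in F) K * K <= _).
    by apply: leq_sum.
  by rewrite sum_nat_const leq_mul2r qF orbT.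
rewrite !leq_add //.
- rewrite exchange_big /=.
  under eq_bigr => a _ do under eq_bigr => b _ do rewrite -big_distrr.
  under eq_bigr => a _ do rewrite -big_distrr.
  by apply: fin => a; apply: sum_link_pair_le.
- under eq_bigr => b _ do under eq_bigr => a _ do rewrite -big_distrr.
  under eq_bigr => b _ do rewrite -big_distrr.
  by apply: fin => b; apply: (@sum_link_pair_le _ _ _ _ _ (fun=> b) (fun=> z)).
- under eq_bigr => b _ do rewrite exchange_big /=.
  rewrite exchange_big /=.
  under eq_bigr => c _ do under eq_bigr => b _ do rewrite -big_distrr.
  under eq_bigr => c _ do rewrite -big_distrr.
  by apply: fin => c; apply: sum_link_pair_le.
Qed.

(** A sum over homomorphisms of the comb, whose vertices may coincide. Starting from the centre [b],
    each vertex is drawn from the neighbours of an earlier one, so degree bounds apply factor by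
    factor. *)
Definition comb_sum (V : finType) (r : rel V) (f : V -> V -> V -> V -> V -> V -> nat) :
    nat :=
  \sum_b \sum_(y | r b y) \sum_(a | r b a) \sum_(c | r b c)
    \sum_(x | r a x) \sum_(z | r c z) f x y z a b c.

Lemma comb_sum_le (V : finType) (r : rel V) f g :
  (forall x y z a b c, r b y -> r b a -> r b c -> r a x -> r c z ->
     f x y z a b c <= g x y z a b c) -> @comb_sum V r f <= comb_sum r g.
Proof.
move=> fg; do 6! [apply: leq_sum => ? ?].
exact: fg.
Qed.

Lemma comb_sumD (V : finType) (r : rel V) f g :
  comb_sum r (fun x y z a b c => f x y z a b c + g x y z a b c) =
  @comb_sum V r f + comb_sum r g.
Proof.
rewrite /comb_sum -big_split; apply: eq_bigr => b _.
do 4! [rewrite -big_split; apply: eq_bigr => ? _].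
by rewrite -big_split.
Qed.

Lemma sum_rotate (A B C : finType) (f : A -> B -> C -> nat) :
  \sum_a \sum_b \sum_c f a b c = \sum_b \sum_c \sum_a f a b c.
Proof. by rewrite exchange_big; apply: eq_bigr => b _; exact: exchange_big. Qed.

(** Forgets adjacency and moves the roots outermost, so that good combs can be bounded triple by
    triple. *)
Lemma comb_sum_free (V : finType) (r : rel V) f :
  @comb_sum V r f <=
  \sum_y \sum_x \sum_z \sum_b \sum_a \sum_c f x y z a b c.
Proof.
apply: leq_trans (_ : \sum_b \sum_y \sum_a \sum_c \sum_x \sum_z f x y z a b c <= _).
  apply: leq_sum => b _.
  do 5! [apply: leq_trans (leq_sum_sub (Q := predT) _ _) _ => //;
         apply: leq_sum => ? _].
apply: eq_leq.
transitivity (\sum_b \sum_y \sum_x \sum_z \sum_a \sum_c f x y z a b c).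
  apply: eq_bigr => b _; apply: eq_bigr => y _.
  rewrite -sum_rotate; apply: eq_bigr => x _; exact: esym (sum_rotate _).
rewrite sum_rotate; apply: eq_bigr => y _; apply: eq_bigr => x _.
exact: exchange_big.
Qed.

Lemma sum_nbr_le (V : finType) (r : rel V) (D k : nat) (v : V) (f : V -> nat) :
  degree r v <= D -> (forall u, f u <= k) -> \sum_(u | r v u) f u <= D * k.
Proof.
move=> hD hf; apply: leq_trans (_ : \sum_(u | r v u) k <= _).
  exact: leq_sum.
by rewrite sum_nat_const leq_mul2r -[#|_|]cardsE hD orbT.
Qed.

Lemma sum_nbr_ge (V : finType) (r : rel V) (d k : nat) (v : V) (f : V -> nat) :
  d <= degree r v -> (forall u, k <= f u) -> d * k <= \sum_(u | r v u) f u.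
Proof.
move=> hD hf; apply: leq_trans (_ : _ <= \sum_(u | r v u) k) _.
  by rewrite sum_nat_const leq_mul2r -[#|_|]cardsE hD orbT.
exact: leq_sum.
Qed.

Lemma sum_scale_le (V : finType) (P : pred V) (k : nat) (f g : V -> nat) :
  (forall u, f u <= k * g u) ->
  \sum_(u | P u) f u <= k * \sum_(u | P u) g u.
Proof. by move=> fg; rewrite big_distrr; apply: leq_sum. Qed.

Lemma sum_eq_le1 (V : finType) (P : pred V) (u : V) :
  \sum_(v | P v) (u == v : nat) <= 1.
Proof.
apply: leq_trans (leq_sum_sub (Q := predT) _ _) _ => //.
by rewrite (bigD1 u) //= eqxx big1 // => v; rewrite eq_sym => /negbTE ->.
Qed.

Lemma sum_all_le (V : finType) (k : nat) (f : V -> nat) :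
  (forall u, f u <= k) -> \sum_u f u <= #|V| * k.
Proof.
move=> hf; rewrite -sum_nat_const; exact: leq_sum.
Qed.

Lemma bad_walks_split (V : finType) (r : rel V) (K : nat) :
  symmetric r ->
  \sum_b \sum_(y | r b y) \sum_(a | r b a) (K <= codeg r y a : nat) =
  \sum_y bad_walks r K y.
Proof.
move=> rS; under eq_bigr do rewrite big_mkcond.
rewrite exchange_big; apply: eq_bigr => y _; rewrite -big_mkcond.
by apply: eq_bigl => b; rewrite rS.
Qed.

(** A homomorphism of the comb is good with distinct roots, or contains one of four bad 2-walks, or
    has one of four coincidences. A placed bad walk leaves three vertices free; a coincidence leaves
    the centre and four others. *)
Lemma regular_count (V : finType) (r : rel V) (q K d D B : nat) :
  symmetric r -> (forall x y z, ~~ rich r q x y z) ->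
  (forall v, d <= degree r v <= D) -> (forall v, bad_walks r K v <= B) ->
  #|V| * d ^ 5 <=
    #|V| ^ 3 * (3 * q * K ^ 2) + 4 * #|V| * D ^ 3 * B + 4 * #|V| * D ^ 4.
Proof.
move=> rS norich hd hB.
have hle v : degree r v <= D by case/andP: (hd v).
have hge v : d <= degree r v by case/andP: (hd v).
pose bad u v : nat := K <= codeg r u v.
have low : #|V| * d ^ 5 <= comb_sum r (fun _ _ _ _ _ _ => 1).
  rewrite -sum_nat_const; apply: leq_sum => b _.
  rewrite -[d ^ 5]muln1 !expnS expn0 muln1 -?mulnA.
  do 5! [apply: sum_nbr_ge => // ?].
apply: leq_trans low _.
apply: leq_trans (comb_sum_le (g := fun x y z a b c =>
   uniq [:: x; y; z] * good_comb r K x y z a b c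
   + bad b x + bad b z + bad y a + bad y c
   + (a == c) + (x == z) + (y == x) + (y == z)) _) _.
  move=> x y z a b c by_ ba bc ax cz.
  rewrite /good_comb /link /bad /= !inE !negb_or ![codeg r x b]codegC !andbT.
  rewrite [r x a]rS [r y b]rS [r a b]rS [r z c]rS [r c b]rS by_ ba bc ax cz /=.
  rewrite ![_ < K]ltnNge [x == y]eq_sym.
  case: (K <= codeg r b x); case: (K <= codeg r b z); case: (K <= codeg r y a);
  case: (K <= codeg r y c); case: (a == c); case: (x == z); case: (y == x);
  by case: (y == z).
rewrite !comb_sumD.
have e4 : #|V| * D ^ 4 = #|V| * (D * (D * (D * (D * 1)))) by rewrite !expnS.
have xz : comb_sum r (fun x y z a b c => x == z) <= #|V| * D ^ 4.
  rewrite e4; apply: sum_all_le => b; do 4! [apply: sum_nbr_le => // ?].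
  exact: sum_eq_le1.
have yz : comb_sum r (fun x y z a b c => y == z) <= #|V| * D ^ 4.
  rewrite e4; apply: sum_all_le => b; do 4! [apply: sum_nbr_le => // ?].
  exact: sum_eq_le1.
have yx : comb_sum r (fun x y z a b c => y == x) <= #|V| * D ^ 4.
  rewrite e4; apply: sum_all_le => b; do 3! [apply: sum_nbr_le => // ?].
  rewrite exchange_big /=; apply: sum_nbr_le => // ?; exact: sum_eq_le1.
have ac : comb_sum r (fun x y z a b c => a == c) <= #|V| * D ^ 4.
  rewrite e4; apply: sum_all_le => b; apply: sum_nbr_le => // y.
  apply: sum_nbr_le => // a.
  apply: leq_trans (_ : D * D * \sum_(c | r b c) (a == c) <= _); last first.
    by rewrite mulnA leq_mul2l sum_eq_le1 orbT.
  apply: sum_scale_le => c; rewrite -mulnA.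
  by do 2! [apply: sum_nbr_le => // ?].
have e5 : #|V| * D ^ 3 * B = #|V| * (D * (D * (D * B))).
  by rewrite !expnS expn0 muln1 -!mulnA.
have bx : comb_sum r (fun x y z a b c => bad b x) <= #|V| * D ^ 3 * B.
  rewrite e5; apply: sum_all_le => b; apply: sum_nbr_le => // y.
  apply: leq_trans (_ : D * D * bad_walks r K b <= _); last first.
    by rewrite mulnA leq_mul2l hB orbT.
  apply: sum_scale_le => a; rewrite -mulnA; apply: sum_nbr_le => // c.
  by apply: sum_scale_le => x; apply: sum_nbr_le.
have bz : comb_sum r (fun x y z a b c => bad b z) <= #|V| * D ^ 3 * B.
  rewrite e5; apply: sum_all_le => b; do 2! [apply: sum_nbr_le => // ?].
  apply: leq_trans (_ : D * bad_walks r K b <= _); last first.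
    by rewrite leq_mul2l hB orbT.
  by apply: sum_scale_le => c; apply: sum_nbr_le.
(* The walks ending at [a] and [c] start at [y], not at the centre, so they are summed over all
   starts [y]. *)
have walks : D ^ 3 * \sum_y bad_walks r K y <= #|V| * D ^ 3 * B.
  rewrite -mulnA mulnCA leq_mul2l; apply/orP; right; exact: sum_all_le.
have ya : comb_sum r (fun x y z a b c => bad y a) <= #|V| * D ^ 3 * B.
  apply: leq_trans walks; rewrite -bad_walks_split //.
  do 3! [apply: sum_scale_le => ?].
  rewrite !expnS expn0 muln1 -!mulnA.
  by do 3! [apply: sum_nbr_le => // ?].
have yc : comb_sum r (fun x y z a b c => bad y c) <= #|V| * D ^ 3 * B.
  apply: leq_trans walks; rewrite -bad_walks_split //.
  do 2! [apply: sum_scale_le => ?].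
  rewrite expnS -mulnA; apply: sum_nbr_le => // a.
  apply: sum_scale_le => c.
  rewrite !expnS expn0 muln1 -!mulnA.
  by do 2! [apply: sum_nbr_le => // ?].
have gd : comb_sum r (fun x y z a b c =>
    uniq [:: x; y; z] * good_comb r K x y z a b c)
    <= #|V| ^ 3 * (3 * q * K ^ 2).
  apply: leq_trans (comb_sum_free _ _) _.
  rewrite !expnS expn0 muln1 -!mulnA.
  apply: sum_all_le => y; apply: sum_all_le => x; apply: sum_all_le => z.
  under eq_bigr => b _ do under eq_bigr => a _ do rewrite -big_distrr.
  under eq_bigr => b _ do rewrite -big_distrr.
  rewrite -big_distrr; case hu: (uniq [:: x; y; z]) => /=;
    last by rewrite mul0n.
  rewrite mul1n; apply: leq_trans (good_combs_le _ rS hu (norich _ _ _)) _.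
  by rewrite !expnS expn0 muln1 -!mulnA.
lia.
Qed.

(** The choice of [K] makes the bad-walk term at most a quarter of [#|V| * d ^ 5], and
    [16 * k ^ 4 <= d] does the same for the coincidences; good combs supply the remaining half. *)
Lemma regular_degree_le (V : finType) (r : rel V) (q k d K : nat) :
  K = 32 * q.+1 * k ^ 5 ->
  symmetric r -> irreflexive r -> (forall x y z, ~~ rich r q x y z) ->
  (forall v, d <= degree r v <= k * d) -> 0 < #|V| -> 0 < k -> 16 * k ^ 4 <= d ->
  d ^ 5 <= 2 * (3 * q * K ^ 2) * #|V| ^ 2.
Proof.
move=> KE rS rI norich hd V0 k0 hk.
have K0 : 16 * q.+1 < K.
  apply: leq_trans (_ : 32 * q.+1 <= _); first by lia.
  by rewrite KE leq_pmulr // expn_gt0 k0.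
have [B hBK hB] : exists2 B, B * K <= 2 * q.+1 * (k * d) ^ 2 &
    forall v, bad_walks r K v <= B.
  exists ((2 * q.+1 * (k * d) ^ 2) %/ K) => [|v]; first exact: leq_trunc_div.
  rewrite leq_divRL; last exact: leq_trans K0.
  rewrite mulnC; apply: leq_trans (bad_walks_le rS rI (norich^~ v) K0) _.
  by rewrite leq_mul2l leq_exp2r //; case/andP: (hd v) => _ ->; rewrite orbT.
have := regular_count rS norich hd hB.
move: (3 * q * _ ^ 2) => M; move: (#|V|) V0 => N N0 hcount.
have h1 : 16 * ((k * d) ^ 3 * B) <= d ^ 5.
  rewrite -(@leq_pmul2l K); last exact: leq_trans K0.
  apply: leq_trans (_ : 16 * (k * d) ^ 3 * (2 * q.+1 * (k * d) ^ 2) <= _).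
    apply: leq_trans (leq_mul (leqnn (16 * (k * d) ^ 3)) hBK).
    by apply: eq_leq; rewrite mulnC -!mulnA.
  have -> : K * d ^ 5 = 32 * q.+1 * (k * d) ^ 5 by rewrite KE -mulnA -expnMn.
  rewrite [(k * d) ^ 5](expnD _ 3 2).
  move: ((k * d) ^ 3) ((k * d) ^ 2); clear; lia.
have h2 : 16 * (k * d) ^ 4 <= d ^ 5.
  by rewrite expnMn mulnA [d ^ 5]expnS leq_mul2r hk orbT.
have h1' := leq_mul (leqnn N) h1; have h2' := leq_mul (leqnn N) h2.
rewrite -(@leq_pmul2l (2 * N)); last by rewrite muln_gt0.
have -> : 2 * N * (2 * M * N ^ 2) = 4 * (N ^ 3 * M).
  by rewrite [N ^ 3]expnS; move: (N ^ 2); clear; lia.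
move: hcount h1' h2'; move: (d ^ 5) ((k * d) ^ 3) ((k * d) ^ 4) (N ^ 3).
clear; lia.
Qed.

(** * Passing to an almost regular vertex subset *)

Definition degree_in (V : finType) (r : rel V) (U : {set V}) (v : V) : nat :=
  \sum_(u in U) (r v u : nat).

Definition edges_in (V : finType) (r : rel V) (U : {set V}) : nat :=
  \sum_(v in U) degree_in r U v.

Lemma degree_in_sub (V : finType) (r : rel V) (A B : {set V}) (v : V) :
  A \subset B -> degree_in r A v <= degree_in r B v.
Proof. by move/subsetP=> AB; apply: leq_sum_sub. Qed.

(** An ordered pair lost with [H] has its first or its second entry in [H]; by symmetry both kinds
    obey the same bound. *)
Lemma edges_in_setD (V : finType) (r : rel V) (U H : {set V}) :
  symmetric r ->
  edges_in r U <= edges_in r (U :\: H) + 2 * \sum_(v in U) degree_in r H v.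
Proof.
move=> rS.
have FE : \sum_(v in U) \sum_(u in U) ((u \in H) * r v u) <=
    \sum_(v in U) degree_in r H v.
  apply: leq_sum => v _; rewrite /degree_in -[X in _ <= X]sum_indicator.
  exact: leq_sum_sub.
have DE : \sum_(v in U) \sum_(u in U) (((v \notin H) && (u \notin H)) * r v u)
    = edges_in r (U :\: H).
  rewrite /edges_in /degree_in.
  under [RHS]eq_bigl do rewrite inE andbC.
  rewrite [RHS]big_mkcondr; apply: eq_bigr => v _.
  case: ifP => hv; last by rewrite big1.
  under [RHS]eq_bigl do rewrite inE andbC.
  rewrite [RHS]big_mkcondr; apply: eq_bigr => u _.
  by case: ifP => _ //=; rewrite mul1n.
have FE' : \sum_(v in U) \sum_(u in U) ((v \in H) * r v u) <=
    \sum_(v in U) degree_in r H v.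
  apply: leq_trans FE; rewrite exchange_big /=.
  by apply: leq_sum => v _; apply: leq_sum => u _; rewrite rS.
rewrite -DE mul2n -addnn.
apply: leq_trans (leq_add (leqnn _) (leq_add FE FE')).
rewrite -!big_split; apply: leq_sum => v _; rewrite -!big_split.
apply: leq_sum => u _ /=.
by case: (v \in H); case: (u \in H); case: (r v u).
Qed.

(** Vertices of degree at most [l / k] are deleted one by one. Each deletion lowers
    [edges_in r U * k] by at most [2 * l], so the strict inequality persists and keeps the set
    nonempty. *)
Lemma min_degree_subset (V : finType) (r : rel V) (k l : nat) (U : {set V}) :
  symmetric r -> 2 * l * #|U| < edges_in r U * k ->
  exists2 U' : {set V}, U' \subset U & U' != set0 /\
    forall v, v \in U' -> l < k * degree_in r U' v.
Proof.
move=> rS; have [n] := ubnP #|U|; elim: n U => // n IHn U ltUn hU.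
have [/existsP[v /andP[vU hv]]|] :=
    boolP [exists v, (v \in U) && (k * degree_in r U v <= l)]; last first.
  rewrite negb_exists => /forallP hmin; exists U => //; split.
    by apply/eqP=> U0; rewrite U0 /edges_in big_set0 in hU.
  by move=> v vU; have := hmin v; rewrite vU -ltnNge.
have cU := cardsD1 v U; rewrite vU in cU.
have [||U' sU' hU'] := IHn (U :\ v).
- by lia.
- have := edges_in_setD U [set v] rS.
  have -> : \sum_(w in U) degree_in r [set v] w = degree_in r U v.
    by apply: eq_bigr => w _; rewrite /degree_in big_set1 rS.
  move=> h; have : edges_in r U * k <=
      edges_in r (U :\ v) * k + 2 * (k * degree_in r U v).
    by have := leq_mul h (leqnn k); lia.
  rewrite cU in hU; lia.
- by exists U' => //; apply: subset_trans sU' (subD1set _ _).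
Qed.

(** Discarding an element of least value never lowers the average of [f]. *)
Lemma heavy_subset (V : finType) (A : {set V}) (f : V -> nat) (k : nat) :
  k <= #|A| ->
  exists S : {set V}, [/\ S \subset A, #|S| = k &
    k * \sum_(v in A) f v <= #|A| * \sum_(v in S) f v].
Proof.
move=> kA; have [j ->] : exists j, k = #|A| - j by exists (#|A| - k); lia.
elim: j => [|j [S [SA cS hS]]]; first by exists A; rewrite subn0.
have [hj|hj] := leqP #|A| j.
  by exists S; rewrite cS; split => //; [lia | have -> : #|A| - j.+1 = #|A| - j by lia].
have /card_gt0P[x0 x0S] : 0 < #|S| by lia.
have [x xS0 hx] := arg_minnP f x0S; have xS : x \in S := xS0.
have sS : #|S| * f x <= \sum_(v in S) f v.
  by rewrite -sum_nat_const; apply: leq_sum => v /hx.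
have cD := cardsD1 x S; rewrite xS in cD.
exists (S :\ x); split; [exact: subset_trans (subD1set _ _) SA | lia |].
rewrite (big_setD1 x xS) /= in sS hS.
move: sS hS cD; rewrite cS; set s := \sum_(i in S :\ x) _.
have [l [-> ->]] : exists l, #|A| - j = l.+1 /\ #|A| - j.+1 = l.
  by exists (#|A| - j.+1); lia.
move: (\sum_(v in A) f v) (#|A|) (f x) => T m fx sS hS _.
rewrite -(@leq_pmul2l l.+1) //.
apply: leq_trans (_ : l * (m * (fx + s)) <= _); first by nia.
by have := leq_mul (leqnn m) (_ : l * fx <= s); nia.
Qed.

(* [edges_in] counts ordered pairs; the ratio [edges / size^(7/5)] is compared
   through fifth powers. *)
Lemma extremal_subset (V : finType) (r : rel V) (C : nat) (U : {set V}) :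
  C * #|U| ^ 7 < edges_in r U ^ 5 ->
  exists U0 : {set V}, C * #|U0| ^ 7 < edges_in r U0 ^ 5 /\
    forall W : {set V}, W \subset U0 ->
      edges_in r W ^ 5 * #|U0| ^ 7 <= edges_in r U0 ^ 5 * #|W| ^ 7.
Proof.
have [n] := ubnP #|U|; elim: n U => // n IHn U ltUn hU.
have [/existsP[W /andP[WU hW]]|] := boolP [exists W : {set V}, (W \subset U) &&
    (edges_in r U ^ 5 * #|W| ^ 7 < edges_in r W ^ 5 * #|U| ^ 7)]; last first.
  rewrite negb_exists => /forallP hext; exists U; split=> // W WU.
  by have := hext W; rewrite WU /= -leqNgt.
(* A violating [W] has a larger ratio, so it inherits the lower bound and the descent on size
   continues. *)
apply: (IHn W).
  apply: leq_trans (_ : #|W| < #|U|) _; last by lia.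
  rewrite proper_card // properEneq WU andbT.
  by apply: contraTneq hW => ->; rewrite ltnn.
move: hU hW; move: (edges_in r U ^ 5) (edges_in r W ^ 5) => a b.
move: (#|U| ^ 7) (#|W| ^ 7) => u w hU hW.
rewrite ltnNge; apply/negP=> hb.
have : b * u <= C * w * u by rewrite leq_mul2r hb orbT.
have : w * (C * u) <= w * a by rewrite leq_mul2l (ltnW hU) orbT.
lia.
Qed.

(* Adding to the set [H] of vertices of large degree the [#|H|] vertices with
   most neighbours in [H] would beat the extremality of [U0] if [H] carried a
   quarter of the edges. *)
Lemma almost_regular_subset (V : finType) (r : rel V) (U0 : {set V}) :
  symmetric r -> 0 < edges_in r U0 ->
  (forall W : {set V}, W \subset U0 ->
     edges_in r W ^ 5 * #|U0| ^ 7 <= edges_in r U0 ^ 5 * #|W| ^ 7) ->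
  exists2 U : {set V}, U \subset U0 & U != set0 /\
    forall v, v \in U -> edges_in r U0 < 8 * #|U0| * degree_in r U v /\
      #|U0| * degree_in r U v <= 2 ^ 9 * edges_in r U0.
Proof.
move=> rS E0 hext; set E := edges_in r U0 in E0 hext *; set m := #|U0| in hext *.
have m0 : 0 < m.
  rewrite lt0n; apply: contraTneq E0 => /eqP.
  by rewrite cards_eq0 => /eqP U00; rewrite /E U00 /edges_in big_set0.
set H := [set v in U0 | 2 ^ 9 * E < m * degree_in r U0 v].
have HU : H \subset U0 by apply/subsetP=> v; rewrite inE => /andP[].
(* Markov: at most a fraction [1 / 2 ^ 9] of the vertices have degree above [2 ^ 9] times the
   average [E / m]. *)
have hm : 2 ^ 9 * #|H| <= m.
  rewrite -(leq_pmul2r E0) mulnAC mulnC -sum_nat_const.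
  apply: leq_trans (_ : \sum_(v in H) m * degree_in r U0 v <= _).
    by apply: leq_sum => v; rewrite inE => /andP[_ /ltnW].
  rewrite -big_distrr leq_mul2l; apply/orP; right.
  by apply: leq_sum_sub; apply/subsetP.
set F := \sum_(v in U0) degree_in r H v.
have hF : 4 * F <= E.
  have [S [SU cS hS]] := heavy_subset (degree_in r H) (subset_leq_card HU).
  rewrite -/F -/m in hS; set W := H :|: S.
  have WU : W \subset U0 by rewrite subUset HU.
  have cW : #|W| <= 2 * #|H|.
    by rewrite mul2n -addnn -{2}cS leq_card_setU.
  have eW : \sum_(v in S) degree_in r H v <= edges_in r W.
    apply: leq_trans (_ : \sum_(v in S) degree_in r W v <= _).
      by apply: leq_sum => v _; apply: degree_in_sub; apply: subsetUl.
    by apply: leq_sum_sub; apply/subsetP; apply: subsetUr.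
  have {}hS : #|H| * F <= m * edges_in r W.
    by apply: leq_trans hS _; rewrite leq_mul2l eW orbT.
  have [h0|h0] := posnP #|H|.
    suff -> : F = 0 by [].
    rewrite /F (cards0_eq h0) big1 // => v _; exact: big_set0.
  have := hext W WU; move: hm hS cW; move: (edges_in r W) (#|W|) => e w.
  move: (#|H|) h0 => h h0 hm hS cW hE.
  (* Extremality of [U0] against [W], using [w <= 2 * h] and [h * F <= m * e]. *)
  have hE' : (h * F) ^ 5 * m ^ 2 <= E ^ 5 * (2 * h) ^ 7.
    apply: leq_trans (_ : (m * e) ^ 5 * m ^ 2 <= _).
      by rewrite leq_mul2r leq_exp2r ?hS ?orbT.
    apply: leq_trans (_ : E ^ 5 * w ^ 7 <= _); last first.
      by rewrite leq_mul2l leq_exp2r ?cW ?orbT.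
    apply: leq_trans hE; rewrite expnMn [m ^ 7](expnD m 5 2).
    by apply: eq_leq; rewrite mulnA [m ^ 5 * _]mulnC.
  have hE2 : F ^ 5 * m ^ 2 <= 2 ^ 7 * E ^ 5 * h ^ 2.
    have h5 : 0 < h ^ 5 by rewrite expn_gt0 h0.
    rewrite -(leq_pmul2l h5); move: hE'; rewrite !expnMn (expnD h 5 2).
    rewrite -[_ * m ^ 2]mulnA => hE'; apply: leq_trans hE' _; apply: eq_leq.
    by move: (E ^ 5) (2 ^ 7) (h ^ 5) (h ^ 2); clear; lia.
  have m2 : 0 < m ^ 2 by rewrite expn_gt0 m0.
  have hE3 : 2 ^ 18 * F ^ 5 <= 2 ^ 7 * E ^ 5.
    rewrite -(leq_pmul2r m2) -mulnA.
    apply: leq_trans (leq_mul (leqnn (2 ^ 18)) hE2) _.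
    rewrite mulnCA leq_mul2l; apply/orP; right.
    by rewrite (expnM 2 9 2) -expnMn leq_exp2r.
  (* The claim reduces to [2 ^ 7 * 4 ^ 5 <= 2 ^ 18], where [2 ^ 18] is the square of the degree
     factor [2 ^ 9]; this fixes the size of that factor. *)
  rewrite -(@leq_exp2r _ _ 5) // expnMn (_ : 4 = 2 ^ 2) // -expnM.
  rewrite -(@leq_pmul2l (2 ^ 7)) ?expn_gt0 // mulnA -expnD.
  apply: leq_trans hE3; rewrite leq_mul2r; apply/orP; right.
  by rewrite leq_exp2l.
(* Without [H] at least half of the edges remain, enough for deleting vertices of degree at most
   [E / (8 * m)] to leave a nonempty set. *)
have hD := edges_in_setD U0 H rS; rewrite -/F -/E in hD.
have [|U sU [Un0 hU]] := @min_degree_subset V r (8 * m) E (U0 :\: H) rS.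
  have cD : #|U0 :\: H| <= m by apply: subset_leq_card; apply: subsetDl.
  have h1 : E <= 2 * edges_in r (U0 :\: H).
    by move: hD hF; move: (edges_in _ _) => ?; lia.
  apply: leq_ltn_trans (_ : 2 * E * m < _); first by rewrite leq_mul2l cD orbT.
  have h2 := leq_mul h1 (leqnn (4 * m)).
  have h3 : 0 < E * m by rewrite muln_gt0 E0.
  move: h2 h3; move: (edges_in _ _) => ?; move: (E) (m); clear; lia.
exists U; first exact: subset_trans sU (subsetDl _ _).
split=> // v vU; split; first exact: hU.
have := subsetP sU v vU; rewrite !inE => /andP[+ vU0].
rewrite vU0 /= -leqNgt; apply: leq_trans.
rewrite leq_mul2l degree_in_sub ?orbT //.
exact: subset_trans sU (subsetDl _ _).
Qed.

(** * Induced subgraphs and the edge bound *)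

Lemma rich_sub (V : finType) (r : rel V) (U : {set V}) (q : nat)
    (x y z : {v | v \in U}) :
  rich (fun u v : {v | v \in U} => r (val u) (val v)) q x y z ->
  rich r q (val x) (val y) (val z).
Proof.
move=> hr; apply/andP; split.
  by case/andP: hr => + _; rewrite -(map_inj_uniq val_inj).
apply/forallP=> F; apply/implyP=> qF.
have [|a [b [c [habc]]]] := comb_avoiding (F := [set u | val u \in F]) hr.
  apply: leq_trans qF; rewrite -(card_imset _ val_inj) subset_leq_card //.
  by apply/subsetP=> _ /imsetP[u + ->]; rewrite inE.
rewrite !inE => aF bF cF.
apply/existsP; exists (val a); apply/existsP; exists (val b).
by apply/existsP; exists (val c); rewrite aF bF cF !andbT.
Qed.

Lemma degree_sub (V : finType) (r : rel V) (U : {set V}) (u : {v | v \in U}) :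
  degree (fun u v : {v | v \in U} => r (val u) (val v)) u = degree_in r U (val u).
Proof.
rewrite /degree /degree_in sum_bool_card -(card_imset _ val_inj); apply: eq_card => v.
apply/imsetP/idP => [[w + ->]|].
  by rewrite !inE (valP w).
by rewrite inE => /andP[vU ruv]; exists (Sub v vU); rewrite ?inE ?SubK.
Qed.

Lemma edges_bound (q : nat) : exists C : nat,
  forall (V : finType) (r : rel V), symmetric r -> irreflexive r ->
    (forall x y z, ~~ rich r q x y z) ->
    edges_in r [set: V] ^ 5 <= C * #|V| ^ 7.
Proof.
(* Degrees will lie between [E / (8 * m)], rounded down to [d], and [2 ^ 9 * E / m]. Rounding costs
   at most a factor two, so the upper bound is at most [16 * 2 ^ 9 * d]. *)
have [k [k0 kE]] : exists k, 0 < k /\ k = 16 * 2 ^ 9.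
  by eexists; split; last reflexivity; rewrite muln_gt0 expn_gt0.
set K := 32 * q.+1 * k ^ 5; set M := 2 * (3 * q * K ^ 2).
(* The summand [M] serves to contradict the final bound on [d ^ 5]; the other one forces [d] to be
   at least [16 * k ^ 4]. *)
have [C CE] : exists C, C = 16 ^ 5 * (M + (16 * k ^ 4) ^ 5) by eexists.
exists C => V r rS rI norich; rewrite -cardsT leqNgt; apply/negP.
case/extremal_subset => U0 [hC hext].
set E := edges_in r U0 in hC hext; set m := #|U0| in hC hext.
have E0 : 0 < E by rewrite lt0n; apply: contraTneq hC => ->; rewrite exp0n.
have [U sU [Un0 hU]] := almost_regular_subset rS E0 hext.
rewrite -/E -/m in hU.
have m0 : 0 < m.
  apply: leq_trans (subset_leq_card sU); by rewrite card_gt0.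
have hC5 X : 16 ^ 5 * X ^ 5 <= C -> 16 * X * m < E.
  move=> hX; rewrite -(@ltn_exp2r _ _ 5) // !expnMn.
  apply: leq_ltn_trans hC; apply: leq_mul => //.
  by rewrite leq_pexp2l.
have hC1 : 16 * (16 * k ^ 4) * m < E.
  by apply: hC5; rewrite CE leq_mul2l leq_addl orbT.
set d := E %/ (8 * m).
have m8 : 0 < 8 * m by rewrite muln_gt0.
have hd : 16 * k ^ 4 <= d.
  rewrite leq_divRL //; apply: leq_trans (ltnW hC1).
  by move: (16 * k ^ 4) => ?; clear; lia.
have d0 : 0 < d by apply: leq_trans hd; rewrite muln_gt0 expn_gt0 k0.
have hE : E < 8 * m * d.+1 by rewrite mulnC ltn_ceil.
have hE16 : E <= 16 * m * d.
  apply: leq_trans (ltnW hE) _; move: d0; clearbody d m; clear; nia.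
have hreg u : d <= degree (fun u v : {v | v \in U} => r (val u) (val v)) u <= k * d.
  rewrite degree_sub; have [hlo hhi] := hU (val u) (valP u).
  move: (degree_in _ _ _) hlo hhi => du hlo hhi; apply/andP; split.
    rewrite -(leq_pmul2l m8) mulnC; apply: leq_trans (leq_trunc_div _ _) _.
    exact: ltnW.
  rewrite -(leq_pmul2l m0); apply: leq_trans hhi _; rewrite kE.
  apply: leq_trans (leq_mul (leqnn (2 ^ 9)) hE16) _; apply: eq_leq.
  by move: (2 ^ 9) => t; clear; lia.
have := @regular_degree_le _ (fun u v : {v | v \in U} => r (val u) (val v))
  q k d K erefl _ _ _ hreg _ k0 hd.
rewrite card_sig -/M => hfin.
have {}hfin : d ^ 5 <= M * m ^ 2.
  apply: leq_trans (hfin _ _ _ _) _.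
  - by move=> u v; apply: rS.
  - by move=> u; apply: rI.
  - by move=> x y z; apply: contra (norich (val x) (val y) (val z)); apply: rich_sub.
  - by rewrite card_gt0.
  - by rewrite leq_mul2l leq_exp2r // subset_leq_card ?orbT.
have : E ^ 5 <= C * m ^ 7.
  apply: leq_trans (_ : (16 * m * d) ^ 5 <= _); first by rewrite leq_exp2r.
  rewrite [m ^ 7](expnD m 5 2) !expnMn CE.
  have -> : 16 ^ 5 * m ^ 5 * d ^ 5 = 16 ^ 5 * d ^ 5 * m ^ 5 by rewrite mulnAC.
  rewrite mulnCA [X in _ <= X]mulnC; apply: leq_mul => //.
  rewrite -mulnA leq_mul2l; apply/orP; right; apply: leq_trans hfin _.
  by rewrite leq_mul2r leq_addr orbT.
by rewrite leqNgt hC.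
Qed.

(** * From rich triples to copies of the comb-pasting *)

Definition adj (V : finType) (G : {set {set V}}) (u v : V) : bool :=
  [set u; v] \in G.

Lemma adj_sym (V : finType) (G : {set {set V}}) : symmetric (adj G).
Proof. by move=> u v; rewrite /adj setUC. Qed.

Lemma adj_irr (V : finType) (G : {set {set V}}) :
  simple_graph G -> irreflexive (adj G).
Proof.
move=> /forallP hG v; apply/negP=> hv.
by have /implyP/(_ hv) := hG [set v; v]; rewrite setUid cards1.
Qed.

(** The roots play the merged pendant vertices and disjoint combs supply the paths. Forbidding the
    three roots from the outset costs three vertices, and [3 + 3 * p.-1] is exactly [3 * p]. *)
Lemma rich_contains_copy (V : finType) (G : {set {set V}}) (p : nat)
    (x y z : V) :
  simple_graph G -> 0 < p -> rich (adj G) (3 * p) x y z ->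
  contains_copy (comb_pasting p) G.
Proof.
move=> hG p0 hr; have rI := adj_irr hG; have rS := @adj_sym V G.
have hu : uniq [:: x; y; z] by case/andP: hr.
have [|t [ht tF tinj]] := disjoint_combs (k := p) (F := [set x; y; z]) hr.
  suff : #|[set x; y; z]| <= 3 by lia.
  by rewrite -setUA !cardsU1 cards1; do 2! case: (_ \in _).
have ord3 (s : 'I_3) : [\/ s = ord0, s = inord 1 | s = inord 2].
  case: s => [[|[|[|]]] hs] //; [apply: Or31 | apply: Or32 | apply: Or33];
  by apply: val_inj; rewrite /= ?inordK.
have rootF (l : 'I_3) : nth x [:: x; y; z] l \in [set x; y; z].
  by case: l => [[|[|[|]]] hl] //=; rewrite !inE eqxx ?orbT.
apply/existsP; exists [ffun w : pasting_vertex p =>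
  match w with
  | inl l => nth x [:: x; y; z] l
  | inr (i, s) => t i s
  end]; apply/andP; split.
  apply/injectiveP => -[l|[i s]] [l'|[j s']]; rewrite !ffunE.
  - by move/eqP; rewrite nth_uniq // => /eqP e; congr inl; apply: val_inj.
  - by move=> e; have := tF j s' (ltn_ord j); rewrite -e rootF.
  - by move=> e; have := tF i s (ltn_ord i); rewrite e rootF.
  move=> e; have ij := tinj _ _ _ _ (ltn_ord i) (ltn_ord j) e.
  have {}ij : i = j by apply: val_inj.
  case: j / ij e => e.
  congr (inr (_, _)); have := ht i (ltn_ord i).
  have neq u v : adj G u v -> u <> v by move=> h e'; rewrite e' rI in h.
  case/and5P=> _ _ _ /neq ba /andP[/neq bc /eqP ac].
  by move: e; case: (ord3 s) => ->; case: (ord3 s') => -> // e; case: notF;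
    move: ba bc ac; rewrite e.
apply/forallP=> e; apply/implyP=> /imsetP[_ /imset2P[i e0 _ he0 ->] ->] {e}.
have := ht i (ltn_ord i).
case/and5P=> ax by_ cz ba /andP[bc _].
rewrite -!imset_comp.
move: he0; rewrite inE => /orP[/imset2P[s s' _]|/imsetP[s _ ->]].
  rewrite inE => /eqP es' ->; rewrite imsetU !imset_set1 /= !ffunE.
  rewrite -/(adj _ _ _).
  case: (ord3 s) (ord3 s') es' => -> [] ->; rewrite /= ?inordK //= => _.
  by rewrite rS.
rewrite imsetU !imset_set1 /= !ffunE -/(adj _ _ _).
by case: (ord3 s) => ->; rewrite /= ?inordK.
Qed.

Lemma card_le_edges_in (V : finType) (G : {set {set V}}) :
  simple_graph G -> #|G| <= edges_in (adj G) [set: V].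
Proof.
move=> /forallP hG.
have -> : edges_in (adj G) [set: V] = #|[set w : V * V | adj G w.1 w.2]|.
  rewrite /edges_in /degree_in pair_big /= sum_bool_card.
  by apply: eq_card => w; rewrite !inE.
apply: leq_trans (leq_imset_card (fun w => [set w.1; w.2]) _).
apply: subset_leq_card; apply/subsetP=> e eG.
have /implyP/(_ eG)/cards2P[u [v [_ ee]]] := hG e.
by apply/imsetP; exists (u, v); rewrite // inE /adj /= -ee.
Qed.

Lemma extremal_number_comb_pasting (p : nat) : 0 < p ->
  exists C : nat, forall n, extremal_number n (comb_pasting p) ^ 5 <= C * n ^ 7.
Proof.
move=> p0; have [C hC] := edges_bound (3 * p); exists C => n.
rewrite /extremal_number.
apply: (big_ind (fun e => e ^ 5 <= C * n ^ 7)); first by rewrite exp0n.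
  by move=> a b; rewrite /maxn; case: ifP.
move=> G /andP[hG hfree].
apply: leq_trans (_ : edges_in (adj G) [set: 'I_n] ^ 5 <= _).
  by rewrite leq_exp2r // card_le_edges_in.
have := hC _ (adj G) (@adj_sym _ _) (adj_irr hG); rewrite card_ord; apply.
by move=> x y z; apply: contra hfree; exact: rich_contains_copy.
Qed.

(* The asymptotic form *)
From mathcomp Require Import all_order all_algebra.
From mathcomp Require Import all_classical all_reals all_analysis.
Import Order.TTheory GRing.Theory Num.Theory.
Import numFieldNormedType.Exports.
Local Open Scope classical_set_scope.
Local Open Scope ring_scope.

Theorem theorem1p9 (R : realType) (p : nat) (hp : (2 <= p)%N) :
  (fun n : nat => (extremal_number n (comb_pasting p))%:R : R)
    =O_\oo (fun n : nat => n%:R `^ (7%:R / 5%:R) : R).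
Proof.
have [C hC] := extremal_number_comb_pasting (ltnW hp).
(* The successor keeps the constant positive even if [C] is zero. *)
apply/eqO_exP; exists (C.+1)%:R; first by rewrite ltr0n.
near=> n.
set e := extremal_number _ _.
rewrite ger0_norm // ger0_norm ?powR_ge0 //.
have h5 : (e%:R : R) ^+ 5 <= (C.+1%:R * n%:R `^ (7%:R / 5%:R)) ^+ 5.
  rewrite exprMn -[(_ `^ _) ^+ 5]powR_mulrn ?powR_ge0 // -powRrM divfK ?pnatr_eq0 //.
  rewrite powR_mulrn // -!natrX -natrM ler_nat.
  (* The constant was raised to the fifth power along with the rest, so [C <= C.+1 ^ 5] suffices. *)
  apply: leq_trans (hC n) _; rewrite leq_mul2r; apply/orP; right.
  by apply: leq_trans (leqnSn C) _; rewrite -{1}(expn1 C.+1) leq_pexp2l.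
by move: h5; rewrite ler_pXn2r // nnegrE ?mulr_ge0 ?powR_ge0.
Unshelve. all: by end_near.
Qed.
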